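(* Let $m\geq 2$, let $F$ be a commutative field with $\mathrm{Char}\,F=2$, and let $V_1,\dots,V_m$ be two-dimensional vector spaces over $F$, each equipped with a symplectic bilinear form $[\cdot,\cdot]:V_k\times V_k\to F$. Let $[\cdot,\cdot]$ also denote the symplectic bilinear form on $\bigotimes_{k=1}^mV_k$ determined by $[a_1\otimes\cdots\otimes a_m,\,b_1\otimes\cdots\otimes b_m]=\prod_{k=1}^m[a_k,b_k]$ for $a_k,b_k\in V_k$. Then there is a unique quadratic form $Q:\bigotimes_{k=1}^mV_k\to F$ satisfying the following two properties: 1. $Q$ vanishes for all decomposable tensors. 2. The symplectic bilinear form $[\cdot,\cdot]:\bigotimes_{k=1}^mV_k\times\bigotimes_{k=1}^mV_k\to F$ is the polar form of $Q$.
   Context: A symplectic bilinear form is a non-degenerate alternating bilinear form. A decomposable tensor is one of the form $a_1\otimes a_2\otimes\cdots\otimes a_m$ with $a_k\in V_k$. The polar form of a quadratic form $Q$ is the bilinear form $(X,Y)\mapsto Q(X+Y)-Q(X)-Q(Y)$. *)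

(* Defs.v *)
From HB Require Import structures.
From mathcomp Require Import all_boot all_order all_algebra.

Set Implicit Arguments.
Unset Strict Implicit.
Unset Printing Implicit Defensive.

Import GRing.Theory.
Local Open Scope ring_scope.

Definition alternating (F : fieldType) (U : lmodType F) (B : {biscalar U}) :=
  forall x, B x x = 0.

(* Two-sidedness is automatic for an alternating form, so the left radical
   suffices. *)
Definition nondegenerate_form (F : fieldType) (U : lmodType F)
    (B : {biscalar U}) :=
  forall x, (forall y, B x y = 0) -> x = 0.

(* The library's [is_psymplectic] is restricted to forms carrying a hermitian
   structure on a [vectType]; here the carrier is any F-module. *)
Definition symplectic (F : fieldType) (U : lmodType F) (B : {biscalar U}) :=
  alternating B /\ nondegenerate_form B.

Definition polar (F : fieldType) (U : lmodType F) (Q : U -> F) (x y : U) : F :=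
  Q (x + y) - Q x - Q y.

Definition quadratic_form (F : fieldType) (U : lmodType F) (Q : U -> F) :=
  [/\ forall c x, Q (c *: x) = c ^+ 2 * Q x,
      forall y, scalar (polar Q ^~ y) &
      forall x, scalar (polar Q x)].

(* [dfwith a x] is the family [a] with its k-th entry replaced by [x : V k]. *)
Definition multilinear (F : fieldType) (I : finType) (V : I -> lmodType F)
    (W : lmodType F) (f : (forall k, V k) -> W) :=
  forall k (a : forall j, V j), linear (fun x : V k => f (dfwith a x)).

(* [T] is characterized by the universal property of [tens], the map sending a
   family [a] to the tensor of its entries. *)
Definition is_tensor_product (F : fieldType) (I : finType)
    (V : I -> lmodType F) (T : lmodType F) (tens : (forall k, V k) -> T) :=
  multilinear tens /\
  forall (W : lmodType F) (f : (forall k, V k) -> W), multilinear f ->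
    exists2 g : {linear T -> W}, (forall a, g (tens a) = f a) &
      forall h : {linear T -> W}, (forall a, h (tens a) = f a) -> h =1 g.

Definition decomposable (F : fieldType) (I : finType) (V : I -> lmodType F)
    (T : lmodType F) (tens : (forall k, V k) -> T) (x : T) :=
  exists a, x = tens a.

(* Main.v *)
Require Import Defs.
From HB Require Import structures.
From mathcomp Require Import all_boot all_order all_algebra ring.
From Stdlib Require Import FunctionalExtensionality.

Set Implicit Arguments.
Unset Strict Implicit.
Unset Printing Implicit Defensive.

Import GRing.Theory.
Local Open Scope ring_scope.

(** Fix in each plane V_k a symplectic basis, written as a family [u k] indexed
    by [bool]. In characteristic 2 the form of V_k is then
    [x, y] = sum_j [x, u_j] [y, u_(~~ j)]. Multiplying over k and distributing
    the product gives the same shape on the tensor product: for e : I -> bool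
    let t_e be the tensor of the vectors u_k(e_k) and ~e the pointwise negation;
    then [x, y] = sum_e [x, t_e] [y, t_(~e)] ([tensor_form_expansion]). This
    holds on decomposable tensors by computation, and everywhere by the universal
    property.

    Existence. Summing over half of the hyperbolic pairs {t_e, t_(~e)} only,
    say those e with e_i true for a chosen index i, the formula
    Q(x) = sum_(e | e_i) [x, t_e] [x, t_(~e)] defines a quadratic form, and its
    polarization restores the missing half of the expansion, so its polar form
    is [., .]. At a decomposable tensor a the half sum factors as a product over
    k; since there are at least two factors, some k differs from i, and its
    factor is [a_k, u_0] [a_k, u_1] + [a_k, u_1] [a_k, u_0] = 0.

    Uniqueness. Non-degeneracy turns the expansion of the form into
    x = sum_e [x, t_e] t_(~e), so every tensor is a linear combination of
    decomposable ones. A quadratic form is determined by its polar form together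
    with its values on a spanning set. *)

Lemma alternating_pchar2_sym (F : fieldType) (U : lmodType F)
    (B : {biscalar U}) (hF : 2%N \in [pchar F]) :
  alternating B -> forall x y, B x y = B y x.
Proof.
move=> altB x y; have := altB (x + y).
rewrite linearDl !linearDr !altB add0r addr0 => /eqP.
by rewrite addr_eq0 oppr_pchar2 // => /eqP.
Qed.

(** Any basis (e, f) works once f is rescaled so that [e, f] = 1. The coordinates
    of x are then [x, f] and [x, e] up to sign, and characteristic 2 makes the
    two terms of the determinant formula symmetric, which is what allows
    indexing them by [bool] with negation as duality. *)
Lemma symplectic_plane_expansion (F : fieldType) (V : vectType F)
    (b : {biscalar V}) (hF : 2%N \in [pchar F]) (dimV : \dim {:V} = 2%N) :
  symplectic b ->
  exists u : bool -> V,
    forall x y, b x y = \sum_(j : bool) b x (u j) * b y (u (~~ j)).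
Proof.
case=> altb ndb; have symb := alternating_pchar2_sym hF altb.
have [e [f [e0 Vef]]] : exists e f : V,
    e != 0 /\ forall x, exists c d, x = c *: e + d *: f.
  have := vbasisP {:V}; move: (vbasis {:V}); rewrite dimV => X.
  case/tupleP: X => e X; case/tupleP: X => f X; rewrite (tuple0 X) /= => /andP[].
  move=> /eqP spanV freeX; exists e, f; split.
    by apply: (free_not0 freeX); rewrite inE eqxx.
  move=> x; have := memvf x.
  rewrite -spanV !span_cons span_nil addv0.
  by case/memv_addP=> _ /vlineP[c ->] [_ /vlineP[d ->] ->]; exists c, d.
have bef0 : b e f != 0.
  apply: contraNneq e0 => bef; apply/eqP/ndb => y.
  by have [c [d ->]] := Vef y; rewrite linearDr !linearZr_LR altb bef !mulr0 addr0.
exists (fun j : bool => if j then e else (b e f)^-1 *: f) => x y.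
have [c [d ->]] := Vef x; have [c' [d' ->]] := Vef y.
rewrite big_bool /= !linearDl !linearDr !linearZl_LR !linearZr_LR !altb /=.
by rewrite (symb f e); field.
Qed.

(** Polarization turns agreement on x and y into agreement on x + y, so two
    quadratic forms with the same polar form agree on a subspace. *)
Lemma quadratic_form_eq_on_span (F : fieldType) (U : lmodType F)
    (Q Q' : U -> F) (I : finType) (c : I -> F) (t : I -> U) :
    quadratic_form Q -> quadratic_form Q' ->
    (forall x y, polar Q x y = polar Q' x y) ->
    (forall i, Q (t i) = Q' (t i)) ->
  Q (\sum_i c i *: t i) = Q' (\sum_i c i *: t i).
Proof.
move=> [Qz _ _] [Q'z _ _] eq_polar eq_t.
have QD R (x y : U) : R (x + y) = polar R x y + R x + R y :> F.
  by rewrite /polar; ring.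
elim/big_rec: _ => [|i x _ IHx].
  by rewrite -[0](scale0r 0) Qz Q'z expr0n !mul0r.
by rewrite (QD Q) (QD Q') eq_polar IHx Qz Q'z eq_t.
Qed.

Lemma tensor_ext (F : fieldType) (I : finType) (V : I -> lmodType F)
    (T W : lmodType F) (tens : (forall k, V k) -> T) (g h : T -> W) :
    is_tensor_product tens -> linear g -> linear h ->
    (forall a, g (tens a) = h (tens a)) ->
  g =1 h.
Proof.
case=> mtens univ lg lh eq_gh x.
pose gL : {linear T -> W} := HB.pack g (GRing.isLinear.Build F T W *:%R g lg).
pose hL : {linear T -> W} := HB.pack h (GRing.isLinear.Build F T W *:%R h lh).
have [|g0 _ uniq_g0] := univ W (fun a => g (tens a)).
  by move=> k a c y z /=; rewrite mtens lg.
have -> : g x = g0 x by apply: (uniq_g0 gL).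
by apply/esym; apply: (uniq_g0 hL) => a; rewrite eq_gh.
Qed.

Definition flip (I : finType) (e : {ffun I -> bool}) : {ffun I -> bool} :=
  [ffun k => ~~ e k].

Lemma flipK (I : finType) : involutive (@flip I).
Proof. by move=> e; apply/ffunP=> k; rewrite !ffunE negbK. Qed.

Definition basis_tensor (F : fieldType) (I : finType) (V : I -> lmodType F)
    (T : lmodType F) (tens : (forall k, V k) -> T) (u : forall k, bool -> V k)
    (e : {ffun I -> bool}) : T :=
  tens (fun k => u k (e k)).

Lemma tensor_form_expansion (F : fieldType) (I : finType) (V : I -> lmodType F)
    (b : forall k, {biscalar (V k)}) (T : lmodType F)
    (tens : (forall k, V k) -> T) (B : {biscalar T})
    (u : forall k, bool -> V k) (t := basis_tensor tens u) :
    is_tensor_product tens ->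
    (forall a c, B (tens a) (tens c) = \prod_k b k (a k) (c k)) ->
    (forall k x y, b k x y = \sum_j b k x (u k j) * b k y (u k (~~ j))) ->
  forall x y, B x y = \sum_e B x (t e) * B y (t (flip e)).
Proof.
move=> hT hB hu x y.
have dec a c : B (tens a) (tens c) =
    \sum_e B (tens a) (t e) * B (tens c) (t (flip e)).
  rewrite hB; under eq_bigr do rewrite hu.
  rewrite bigA_distr_bigA; apply: eq_bigr => e _.
  rewrite !hB -big_split; apply: eq_bigr => k _.
  by rewrite /= ffunE.
(* The universal property extends the expansion to all tensors first in the
   second argument, the first one being decomposable, and then in the first. *)
have dec_l a z : B (tens a) z = \sum_e B (tens a) (t e) * B z (t (flip e)).
  move: z; apply: (@tensor_ext _ _ _ _ F^o _ _ _ hT) => [c z w|c z w|c] //=.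
    by rewrite linearPr.
  rewrite /GRing.scale /= mulr_sumr -big_split; apply: eq_bigr => e _ /=.
  by rewrite linearPl /=; ring.
move: x; apply: (@tensor_ext _ _ _ _ F^o _ _ _ hT) => [c z w|c z w|a] //=.
  by rewrite linearPl.
rewrite /GRing.scale /= mulr_sumr -big_split; apply: eq_bigr => e _ /=.
by rewrite linearPl /=; ring.
Qed.

(** The element paired with z by the right-hand side below is the expansion of
    the form at x and z, so non-degeneracy identifies it with x. *)
Lemma form_expansion_spans (F : fieldType) (I : finType) (U : lmodType F)
    (B : {biscalar U}) (t : {ffun I -> bool} -> U) :
    nondegenerate_form B -> (forall x y, B x y = B y x) ->
    (forall x y, B x y = \sum_e B x (t e) * B y (t (flip e))) ->
  forall x, x = \sum_e B x (t e) *: t (flip e).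
Proof.
move=> ndB symB expB x; apply/eqP; rewrite -subr_eq0; apply/eqP/ndB => y.
rewrite linearBl linear_sumlz /= {1}expB; apply/eqP; rewrite subr_eq0; apply/eqP.
by apply: eq_bigr => e _; rewrite linearZl_LR /= (symB y).
Qed.

Definition half_form (F : fieldType) (I : finType) (U : lmodType F)
    (B : {biscalar U}) (t : {ffun I -> bool} -> U) (i : I) (x : U) : F :=
  \sum_(e : {ffun I -> bool} | e i) B x (t e) * B x (t (flip e)).

Lemma polar_half_form (F : fieldType) (I : finType) (U : lmodType F)
    (B : {biscalar U}) (t : {ffun I -> bool} -> U) (i : I) :
    (forall x y, B x y = \sum_e B x (t e) * B y (t (flip e))) ->
  forall x y, polar (half_form B t i) x y = B x y.
Proof.
move=> expB x y; rewrite expB (bigID (fun e : {ffun I -> bool} => e i)) /=.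
(* The terms missing from the half sum are the mixed terms of the polarization
   with the two members of the pair exchanged. *)
rewrite [X in _ + X](reindex_inj (inv_inj (@flipK I))) /=.
rewrite [X in _ + X](eq_bigl (fun e : {ffun I -> bool} => e i)); last first.
  by move=> e; rewrite ffunE negbK.
rewrite /polar /half_form -!sumrB -big_split; apply: eq_bigr => e _ /=.
by rewrite flipK !linearDl /=; ring.
Qed.

Lemma quadratic_half_form (F : fieldType) (I : finType) (U : lmodType F)
    (B : {biscalar U}) (t : {ffun I -> bool} -> U) (i : I) :
    (forall x y, B x y = \sum_e B x (t e) * B y (t (flip e))) ->
  quadratic_form (half_form B t i).
Proof.
move=> expB; have pB := polar_half_form i expB; split.
- move=> c x; rewrite /half_form mulr_sumr; apply: eq_bigr => e _.
  by rewrite !linearZl_LR /=; ring.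
- by move=> y c x z; rewrite !pB linearPl.
- by move=> x c y z; rewrite !pB linearPr.
Qed.

(** At a decomposable tensor the half sum distributes into a product over the
    factors; the constraint on e bears on index i only, so the factor at i' sums
    a symmetric expression over both values of the boolean, hence is twice
    something. *)
Lemma half_form_decomposable (F : fieldType) (I : finType)
    (V : I -> lmodType F) (b : forall k, {biscalar (V k)}) (T : lmodType F)
    (tens : (forall k, V k) -> T) (B : {biscalar T})
    (u : forall k, bool -> V k) (i i' : I) (hF : 2%N \in [pchar F]) :
    i' != i ->
    (forall a c, B (tens a) (tens c) = \prod_k b k (a k) (c k)) ->
  forall a, half_form B (basis_tensor tens u) i (tens a) = 0.
Proof.
move=> ne_i hB a; rewrite /half_form.
pose G k j := b k (a k) (u k j) * b k (a k) (u k (~~ j)).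
pose P k := [pred j : bool | (k == i) ==> j].
transitivity (\sum_(e in family P) \prod_k G k (e k)).
  apply: eq_big => [e|e _].
    apply/idP/familyP => [ei k|/(_ i)]; last by rewrite inE eqxx.
    by rewrite inE; apply/implyP=> /eqP->.
  rewrite !hB -big_split; apply: eq_bigr => k _.
  by rewrite /G /= ffunE.
rewrite -(bigA_distr_big_dep P G) (bigD1 i') //=.
rewrite (eq_bigl predT); last by move=> j; rewrite (negbTE ne_i).
rewrite big_bool /G /= [X in _ + X]mulrC addrr_pchar2 // mul0r //.
Qed.

Theorem proposition1 (m : nat) (F : fieldType) (V : 'I_m -> vectType F)
    (b : forall k, {biscalar (V k)})
    (T : lmodType F) (tens : (forall k, V k) -> T) (B : {biscalar T})
    (hm : (2 <= m)%N)
    (hF : 2%N \in [pchar F])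
    (hV : forall k, \dim {:V k} = 2%N)
    (hb : forall k, symplectic (b k))
    (hT : is_tensor_product tens)
    (hB : symplectic B)
    (hBtens : forall a c : forall k, V k,
      B (tens a) (tens c) = \prod_(k < m) b k (a k) (c k)) :
  exists! Q : T -> F,
    [/\ quadratic_form Q,
        forall x, decomposable tens x -> Q x = 0 &
        forall x y, B x y = polar Q x y].
Proof.
have [u hu] := fin_all_exists
  (fun k => symplectic_plane_expansion hF (hV k) (hb k)).
pose t := basis_tensor tens u.
have expB := tensor_form_expansion hT hBtens hu.
have [altB ndB] := hB.
have spanT := form_expansion_spans ndB (alternating_pchar2_sym hF altB) expB.
pose i0 : 'I_m := Ordinal (ltnW hm); pose i1 : 'I_m := Ordinal hm.
have qQ := quadratic_half_form i0 expB.
have pQ := polar_half_form i0 expB.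
have dQ : forall a, half_form B t i0 (tens a) = 0.
  exact: (half_form_decomposable u (i := i0) (i' := i1) hF).
exists (half_form B t i0); split; first by split=> // _ [a ->].
move=> Q' [qQ' dQ' pQ']; apply: functional_extensionality => x.
rewrite [x]spanT; apply: quadratic_form_eq_on_span => // [y z|e].
  by rewrite pQ pQ'.
by rewrite dQ dQ' //; eexists.
Qed.
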